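(* Let $r\in\mathbb{N}$, $n\in\mathbb{N}_0$, $x\in\mathbb{C}$, and $\lambda\in\mathbb{C}$ with $|\lambda|<1$. Then $$\Phi^{B,r}_{M,\lambda}(-n,x)=(-1)^r\frac{M_n!}{M_{n+r}!}B^{(r)}_{n+r,M}(x;\lambda),$$ where $B^{(r)}_{n,M}(x;\lambda)$ denotes the Apostol-Mersenne-Bernoulli polynomial of order $r$.
   Context: $\mathbb{N}=\{1,2,\ldots\}$, $\mathbb{N}_0=\{0,1,2,\ldots\}$. For $n\ge 0$, $M_n=2^n-1$. The M-factorial is $M_0!=1$ and $M_n!=M_nM_{n-1}\cdots M_1$ for $n\geq 1$. The M-exponential is $e_M^{xt}=\sum_{n=0}^{\infty}\frac{x^nt^n}{M_n!}$, and $e_M^t$ denotes the case $x=1$. For $m\in\mathbb{N}_0$ the Mersenne translation polynomials $P_{n,M}(x;m)$ are defined by $e_M^{xt}\left(e_M^t\right)^m=\sum_{n=0}^{\infty}P_{n,M}(x;m)\frac{t^n}{M_n!}$, where $(e_M^t)^m$ is the ordinary $m$-fold product. For $r\in\mathbb{N}$, $n\in\mathbb{N}_0$, $x\in\mathbb{C}$ and $|\lambda|<1$, the Bernoulli-type Mersenne-Lerch interpolation value of order $r$ at $-n$ is the (convergent) series $\Phi^{B,r}_{M,\lambda}(-n,x)=\sum_{m=0}^{\infty}\binom{m+r-1}{m}\lambda^mP_{n,M}(x;m)$, where $\binom{m+r-1}{m}$ is the ordinary binomial coefficient and $\lambda^0=1$. The Apostol-Mersenne-Bernoulli polynomials of order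 $r$ are defined by the power series expansion in $t$ (at $t=0$) $\left(\frac{t}{\lambda e_M^t-1}\right)^r e_M^{xt}=\sum_{n=0}^{\infty}B^{(r)}_{n,M}(x;\lambda)\frac{t^n}{M_n!}$. *)

(* Defs.v *)
From HB Require Import structures.
From mathcomp Require Import all_boot all_order all_algebra.
From mathcomp Require Import all_classical all_reals all_analysis.
From mathcomp Require Import complex.

Set Implicit Arguments.
Unset Strict Implicit.
Unset Printing Implicit Defensive.

Import Order.TTheory GRing.Theory Num.Theory.
Import numFieldNormedType.Exports.

Local Open Scope classical_set_scope.
Local Open Scope ring_scope.

(** MathComp's [R[i]] carries no topology by itself; give it the one of its
    modulus. *)
HB.instance Definition _ (R : realType) := NormedModule.copy R[i] R[i]^o.

(** Generating functions are read as formal power series in [t]: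
    [fps_coef f n] is the coefficient of [t ^+ n], and a series is a unit
    exactly when its constant term is nonzero. *)

Section FormalPowerSeries.
Variable K : fieldType.

Record fps := FPS { fps_coef : nat -> K }.

Lemma fpsP (f g : fps) : fps_coef f =1 fps_coef g -> f = g.
Proof. by case: f g => [f] [g] /= fg; congr FPS; apply: funext. Qed.

HB.instance Definition _ := gen_eqMixin fps.
HB.instance Definition _ := gen_choiceMixin fps.

Definition fps_zero := FPS (fun=> 0).
Definition fps_opp f := FPS (fun n => - fps_coef f n).
Definition fps_add f g := FPS (fun n => fps_coef f n + fps_coef g n).
Definition fps_one := FPS (fun n => (n == 0)%:R).
Definition fps_mul f g :=
  FPS (fun n => \sum_(i < n.+1) fps_coef f i * fps_coef g (n - i)%N).
Definition fps_scale (a : K) f := FPS (fun n => a * fps_coef f n).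

Fact fps_addA : associative fps_add.
Proof. by move=> f g h; apply: fpsP => n /=; rewrite addrA. Qed.
Fact fps_addC : commutative fps_add.
Proof. by move=> f g; apply: fpsP => n /=; rewrite addrC. Qed.
Fact fps_add0 : left_id fps_zero fps_add.
Proof. by move=> f; apply: fpsP => n /=; rewrite add0r. Qed.
Fact fps_addN : left_inverse fps_zero fps_opp fps_add.
Proof. by move=> f; apply: fpsP => n /=; rewrite addNr. Qed.

HB.instance Definition _ :=
  GRing.isZmodule.Build fps fps_addA fps_addC fps_add0 fps_addN.

(** Products are computed on truncations, where they are products of
    polynomials. *)
Definition fps_trunc n f : {poly K} := \poly_(i < n.+1) fps_coef f i.

Lemma coef_fps_mul m n f g : (m <= n)%N ->
  fps_coef (fps_mul f g) m = (fps_trunc n f * fps_trunc n g)`_m.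
Proof.
move=> mn; rewrite coefM /=; apply: eq_bigr => i _; rewrite !coef_poly !ltnS.
by rewrite (leq_trans (leq_ord i) mn) (leq_trans (leq_subr i m) mn).
Qed.

Lemma coef_fps_trunc m n f : (m <= n)%N -> (fps_trunc n f)`_m = fps_coef f m.
Proof. by move=> mn; rewrite coef_poly ltnS mn. Qed.

Fact fps_mulC : commutative fps_mul.
Proof.
by move=> f g; apply: fpsP => n; rewrite !(@coef_fps_mul n n)// mulrC.
Qed.

Fact fps_mulA : associative fps_mul.
Proof.
move=> f g h; apply: fpsP => n.
have E1 : fps_coef (fps_mul f (fps_mul g h)) n =
    (fps_trunc n f * (fps_trunc n g * fps_trunc n h))`_n.
  rewrite coefM /=; apply: eq_bigr => i _.
  rewrite coef_fps_trunc ?leq_ord// -(@coef_fps_mul _ n)//.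
  exact: leq_subr.
have E2 : fps_coef (fps_mul (fps_mul f g) h) n =
    (fps_trunc n f * fps_trunc n g * fps_trunc n h)`_n.
  rewrite coefM /=; apply: eq_bigr => i _.
  by rewrite coef_fps_trunc ?leq_subr// -(@coef_fps_mul _ n) ?leq_ord.
by rewrite E1 E2 mulrA.
Qed.

Fact fps_mul1 : left_id fps_one fps_mul.
Proof.
move=> f; apply: fpsP => n /=; rewrite big_ord_recl /= mul1r subn0.
by rewrite big1 ?addr0// => i _; rewrite mul0r.
Qed.

Fact fps_mulDl : left_distributive fps_mul fps_add.
Proof.
move=> f g h; apply: fpsP => n /=; rewrite -big_split /=.
by apply: eq_bigr => i _; rewrite mulrDl.
Qed.

Fact fps_one_neq0 : fps_one != 0.
Proof.
by apply/eqP => /(congr1 (fps_coef^~ 0)) /= /eqP; rewrite oner_eq0.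
Qed.

HB.instance Definition _ := GRing.Zmodule_isComNzRing.Build fps
  fps_mulA fps_mulC fps_mul1 fps_mulDl fps_one_neq0.

Fact fps_scaleA a b f :
  fps_scale a (fps_scale b f) = fps_scale (a * b) f.
Proof. by apply: fpsP => n /=; rewrite mulrA. Qed.
Fact fps_scale1 : left_id 1 fps_scale.
Proof. by move=> f; apply: fpsP => n /=; rewrite mul1r. Qed.
Fact fps_scaleDr : right_distributive fps_scale +%R.
Proof. by move=> a f g; apply: fpsP => n /=; rewrite mulrDr. Qed.
Fact fps_scaleDl f : {morph fps_scale^~ f : a b / a + b}.
Proof. by move=> a b; apply: fpsP => n /=; rewrite mulrDl. Qed.

HB.instance Definition _ := GRing.Zmodule_isLmodule.Build K fps
  fps_scaleA fps_scale1 fps_scaleDr fps_scaleDl.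

Fact fps_scaleAl (a : K) (f g : fps) : a *: (f * g) = a *: f * g.
Proof.
apply: fpsP => n /=; rewrite mulr_sumr.
by apply: eq_bigr => i _; rewrite mulrA.
Qed.

HB.instance Definition _ := GRing.Lmodule_isLalgebra.Build K fps fps_scaleAl.

Fact fps_scaleAr (a : K) (f g : fps) : a *: (f * g) = f * (a *: g).
Proof. by rewrite mulrC fps_scaleAl mulrC. Qed.

HB.instance Definition _ := GRing.Lalgebra_isAlgebra.Build K fps fps_scaleAr.

(** [fps_inv_seq f n] lists the first [n.+1] coefficients of [1 / f]. *)
Fixpoint fps_inv_seq (f : fps) (n : nat) : seq K :=
  if n is n'.+1 then
    let s := fps_inv_seq f n' in
    rcons s (- (fps_coef f 0)^-1 *
      \sum_(i < n'.+1) fps_coef f i.+1 * s`_(n' - i))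
  else [:: (fps_coef f 0)^-1].

Definition fps_unit : pred fps := [pred f | fps_coef f 0 != 0].
Definition fps_inv f :=
  if fps_unit f then FPS (fun n => (fps_inv_seq f n)`_n) else f.

Lemma size_fps_inv_seq f n : size (fps_inv_seq f n) = n.+1.
Proof. by elim: n => //= n IH; rewrite size_rcons IH. Qed.

Lemma nth_fps_inv_seq f m n : (m <= n)%N ->
  (fps_inv_seq f n)`_m = (fps_inv_seq f m)`_m.
Proof.
elim: n => [|n IH]; first by rewrite leqn0 => /eqP ->.
rewrite leq_eqVlt => /orP[/eqP -> //|]; rewrite ltnS => mn.
by rewrite [in LHS]/= nth_rcons size_fps_inv_seq ltnS mn IH.
Qed.

Fact fps_mulVf : {in fps_unit, left_inverse 1 fps_inv *%R}.
Proof.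
move=> f f0; rewrite /fps_inv ifT// mulrC.
have {}f0 : fps_coef f 0 != 0 by [].
apply: fpsP => -[|n] /=; first by rewrite big_ord_recl big_ord0 addr0 mulfV.
rewrite big_ord_recl subn0 /= nth_rcons size_fps_inv_seq ltnn eqxx.
rewrite mulNr mulrN mulVKf// addrC; apply/eqP; rewrite subr_eq0; apply/eqP.
apply: eq_bigr => i _; rewrite /= /bump add1n subSS.
by rewrite [in RHS]nth_fps_inv_seq// leq_subr.
Qed.

Fact fps_unitPl (f g : fps) : g * f = 1 -> f \in fps_unit.
Proof.
move=> /(congr1 (fps_coef^~ 0)) /=; rewrite big_ord_recl big_ord0 addr0 /= => h.
by apply: contra_eq_neq h => ->; rewrite mulr0 eq_sym oner_eq0.
Qed.

Fact fps_inv_out : {in [predC fps_unit], fps_inv =1 id}.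
Proof. by move=> f /negbTE fU; rewrite /fps_inv ifF. Qed.

HB.instance Definition _ := GRing.ComNzRing_hasMulInverse.Build fps
  fps_mulVf fps_unitPl fps_inv_out.

Definition fps_t : fps := FPS (fun n => (n == 1)%:R).

End FormalPowerSeries.

Definition mersenne (n : nat) : nat := 2 ^ n - 1.

Definition mfact (n : nat) : nat := \prod_(1 <= k < n.+1) mersenne k.

Lemma mfact_gt0 n : (0 < mfact n)%N.
Proof.
rewrite /mfact big_nat_cond prodn_cond_gt0// => k /andP[/andP[k0 _] _].
by rewrite subn_gt0 -{1}(expn0 2) ltn_exp2l.
Qed.

Section MersenneSeries.
Variable K : fieldType.

(** [mexp x] is [e_M^{xt}]. *)
Definition mexp (x : K) : fps K := FPS (fun n => x ^+ n / (mfact n)%:R).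

(** [mcoef f] is the sequence [a] such that [f = \sum_n a n * t ^+ n / M_n!]. *)
Definition mcoef (f : fps K) (n : nat) : K := fps_coef f n * (mfact n)%:R.

Definition mersenne_translation (n : nat) (x : K) (m : nat) : K :=
  mcoef (mexp x * mexp 1 ^+ m) n.

(** As [mexp 1] has constant term 1, the denominator is a unit exactly when
    [lam != 1]. *)
Definition apostol_mersenne_bernoulli (r n : nat) (x lam : K) : K :=
  mcoef ((fps_t K / (lam *: mexp 1 - 1)) ^+ r * mexp x) n.

End MersenneSeries.

Lemma mcoefK (K : numFieldType) (f : fps K) :
  f = FPS (fun n => mcoef f n / (mfact n)%:R).
Proof.
apply: fpsP => n; rewrite /= /mcoef mulfK//.
by rewrite pnatr_eq0 -lt0n mfact_gt0.
Qed.

Lemma apostol_denominator_unit (K : numFieldType) (lam : K) :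
  `|lam| < 1 -> lam *: mexp 1 - 1 \is a @GRing.unit (fps K).
Proof.
move=> lam1; suff: lam - 1 != 0.
  rewrite [X in _ -> X]/=; rewrite unfold_in /= /fps_unit /=.
  by rewrite /mfact big_geq// expr1n divr1 mulr1.
by rewrite subr_eq0; apply: contraTneq lam1 => ->; rewrite normr1 ltxx.
Qed.

Section MersenneLerch.
Variable R : realType.
Local Notation C := R[i].

(** The general term of the series [Phi^{B,r}_{M,lam}(-n,x)]; the natural
    subtraction is exact for [0 < r]. *)
Definition mersenne_lerch_term (r n : nat) (x lam : C) (m : nat) : C :=
  'C(m + r - 1, m)%:R * lam ^+ m * mersenne_translation n x m.

(** The Lerch value is taken at [-n]; the argument [n] is the natural number. *)
Definition mersenne_lerch (r n : nat) (x lam : C) : C :=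
  limn (series (mersenne_lerch_term r n x lam)).

End MersenneLerch.

(* Main.v *)
Require Import Defs.
From HB Require Import structures.
From mathcomp Require Import all_boot all_order all_algebra.
From mathcomp Require Import all_classical all_reals all_analysis.
From mathcomp Require Import complex ring.

Import Order.TTheory GRing.Theory Num.Theory.
Import numFieldNormedType.Exports.

Local Open Scope classical_set_scope.
Local Open Scope ring_scope.

(** Put [A = lam e_M^t], a power series with constant term [lam].  The negative
    binomial series [\sum_m 'C(m + r - 1, m) A^m] sums to [(1 - A)^-r], and
    multiplying by [e_M^{xt}] and reading off the coefficient of [t^n] turns its
    left-hand side into the Lerch series at [-n].  On the other side,
    [(t / (A - 1))^r = (-1)^r t^r (1 - A)^-r], so the same coefficient is, up
    to sign and M-factorials, the Bernoulli polynomial of index [n + r]; this is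
    [apostol_mersenne_bernoulli_shift].

    What has to be justified is that the negative binomial series converges
    coefficientwise even when the constant term of [A] is nonzero, so that every
    power [A^m] contributes to the coefficient of [t^n].  By Pascal's rule the
    partial sums [S r N] for the exponent [r + 1] satisfy
    [S r.+1 N.+1 = A * S r.+1 N + S r N.+1], and such an affine recurrence
    propagates convergence ([cvg_fps_affine_rec]), which replaces growth
    estimates on the coefficients of [A^m].  Indeed its [n]-th coefficient is a
    scalar recurrence [u m.+1 = lam * u m + v m] in which [v] involves only
    lower coefficients and the inhomogeneous term, and [|lam| < 1] makes [u]
    converge as soon as [v] does ([cvg_affine_rec]). *)

Set Implicit Arguments.
Unset Strict Implicit.

(** The modulus of [a] and the tolerance, being real, are compared inside the
    archimedean field [R], where geometric sequences tend to zero. *)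
Lemma cvg_exprC (R : realType) (a : R[i]) :
  `|a| < 1 -> (GRing.exp a : nat -> R[i]) @ \oo --> 0.
Proof.
move=> a1; set q : R := complex.Re `|a|.
have aE : `|a| = q%:C%C by rewrite /q normc_def.
have q0 : 0 <= q by rewrite -ler0c -aE.
have q1 : `|q| < 1 by rewrite ger0_norm// -ltcR -aE.
apply/cvgrPdist_lt => e e0.
have eE : e = (complex.Re e)%:C%C by rewrite RRe_real// gtr0_real.
have e0' : 0 < complex.Re e by rewrite -ltcR -eE.
have [N _ qN] := (cvgrPdist_lt _ _).1 (cvg_geometric 1 q1) _ e0'.
exists N => // k /qN; rewrite /= /geometric /= mul1r !sub0r !normrN => h.
rewrite normrX aE -rmorphXn eE ltcR.
by apply: le_lt_trans h; exact: ler_norm.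
Qed.

(** The error [l - u m] is contracted by [a] at each step, up to a perturbation
    [(1 - a) * l - v m] that tends to zero. *)
Lemma cvg_affine_rec (R : realType) (a l : R[i]) (u v : nat -> R[i]) :
  `|a| < 1 -> (forall m, u m.+1 = a * u m + v m) ->
  v @ \oo --> (1 - a) * l -> u @ \oo --> l.
Proof.
move=> a1 uE /cvgrPdist_le vl; apply/cvgrPdist_le => e e0.
have a1' : 0 < 1 - `|a| by rewrite subr_gt0.
have e20 : 0 < e / 2 by rewrite divr_gt0.
(* A perturbation of at most [(1 - |a|) e/2] keeps the bound [e/2] stable. *)
have [N _ vN] := vl _ (mulr_gt0 a1' e20).
pose d := l - u N.
have ub k : `|l - u (k + N)%N| <= `|a| ^+ k * `|d| + e / 2.
  elim: k => [|k IH]; first by rewrite expr0 mul1r lerDl ltW.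
  rewrite addSn uE.
  have -> : l - (a * u (k + N)%N + v (k + N)%N) =
      a * (l - u (k + N)%N) + ((1 - a) * l - v (k + N)%N).
    by ring.
  apply: le_trans (ler_normD _ _) _; rewrite normrM.
  apply: le_trans (lerD (ler_wpM2l (normr_ge0 a) IH) (vN _ (leq_addl _ _))) _.
  by rewrite mulrDr mulrA -exprS mulrBl mul1r -addrA [_ + (_ - _)]addrC subrK.
have /cvgrPdist_le ad : (fun k => a ^+ k * d) @ \oo --> 0.
  by rewrite -(mul0r d); apply: cvgMr_tmp; exact: cvg_exprC.
have [K _ aK] := ad _ e20.
exists (K + N)%N => // m /= Km.
rewrite -(subnK (leq_trans (leq_addl K N) Km)).
apply: le_trans (ub _) _; rewrite [leRHS](splitr e) lerD2r.
have := aK (m - N)%N; rewrite /= sub0r normrN normrM normrX; apply.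
by rewrite leq_subRL ?(leq_trans (leq_addl K N) Km)// addnC.
Qed.

Lemma fps_coefD (K : fieldType) (f g : fps K) n :
  fps_coef (f + g) n = fps_coef f n + fps_coef g n.
Proof. by []. Qed.

Lemma fps_coefM (K : fieldType) (f g : fps K) n :
  fps_coef (f * g) n = \sum_(i < n.+1) fps_coef f i * fps_coef g (n - i)%N.
Proof. by []. Qed.

Lemma fps_coef_sum (K : fieldType) (I : Type) (s : seq I) (f : I -> fps K) n :
  fps_coef (\sum_(i <- s) f i) n = \sum_(i <- s) fps_coef (f i) n.
Proof.
by elim: s => [|i s IH]; rewrite ?big_nil// !big_cons fps_coefD IH.
Qed.

Lemma fps_coefMn (K : fieldType) (f : fps K) k n :
  fps_coef (f *+ k) n = k%:R * fps_coef f n.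
Proof.
elim: k => [|k IH]; first by rewrite mul0r.
by rewrite mulrSr fps_coefD IH -[k.+1]addn1 natrD mulrDl mul1r.
Qed.

Lemma fps_coefZ (K : fieldType) (a : K) (f : fps K) n :
  fps_coef (a *: f) n = a * fps_coef f n.
Proof. by []. Qed.

Lemma fps_unitE (K : fieldType) (f : fps K) :
  (f \is a GRing.unit) = (fps_coef f 0 != 0).
Proof. by []. Qed.

Lemma fps_coef_tXM (K : fieldType) (f : fps K) r n :
  fps_coef (fps_t K ^+ r * f) (n + r) = fps_coef f n.
Proof.
elim: r => [|r IH]; first by rewrite expr0 mul1r addn0.
rewrite exprS -mulrA addnS fps_coefM 2!big_ord_recl mul0r add0r.
rewrite mul1r subSS subn0 IH big1 ?addr0// => i _.
by rewrite mul0r.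
Qed.

(** Coefficients converge one after the other: in the product [A * U m], the
    coefficient of index [n] of [U m] is multiplied by the constant term of [A]
    only, and the remaining terms come from coefficients of smaller index. *)
Lemma cvg_fps_affine_rec (R : realType) (A L : fps R[i])
    (U V : nat -> fps R[i]) :
  `|fps_coef A 0| < 1 ->
  (forall m, U m.+1 = A * U m + V m) ->
  (forall n,
    (fun m => fps_coef (V m) n) @ \oo --> fps_coef ((1 - A) * L) n) ->
  forall n, (fun m => fps_coef (U m) n) @ \oo --> fps_coef L n.
Proof.
move=> A1 UE VL n; elim/ltn_ind: n => n IH.
apply: (@cvg_affine_rec _ (fps_coef A 0) _ _ (fun m =>
  \sum_(i < n) fps_coef A i.+1 * fps_coef (U m) (n - i.+1) + fps_coef (V m) n)).
- by [].
- by move=> m; rewrite UE fps_coefD fps_coefM big_ord_recl subn0 -addrA.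
(* Coefficient [n] of the identity [L = A * L + (1 - A) * L]. *)
have -> : (1 - fps_coef A 0) * fps_coef L n =
    \sum_(i < n) fps_coef A i.+1 * fps_coef L (n - i.+1) +
    fps_coef ((1 - A) * L) n.
  have LE : L = A * L + (1 - A) * L by rewrite mulrBl mul1r addrC subrK.
  rewrite mulrBl mul1r {1}LE fps_coefD fps_coefM big_ord_recl subn0.
  by rewrite addrAC; congr (_ + _); rewrite addrC addKr.
apply: cvgD; last exact: VL.
apply: cvg_big => [|i _]; first exact: add_continuous.
apply: cvgMl_tmp; apply: IH.
by rewrite ltn_subrL; case: (n) i => [[]|].
Qed.

(** Partial sums of the negative binomial expansion of [(1 - A) ^- r.+1 * F];
    the exponent is [r.+1] so that the binomial coefficients need no
    subtraction. *)
Definition negbin_sum (K : fieldType) (A F : fps K) (r N : nat) : fps K :=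
  \sum_(0 <= m < N) (A ^+ m * F) *+ 'C(m + r, m).

Lemma negbin_sum0S (K : fieldType) (A F : fps K) N :
  negbin_sum A F 0 N.+1 = A * negbin_sum A F 0 N + F.
Proof.
rewrite /negbin_sum big_nat_recl// expr0 mul1r bin0 addrC mulr_sumr.
by congr (_ + _); apply: eq_bigr => m _; rewrite !addn0 !binn exprS mulrA.
Qed.

(** Pascal's rule, in the form [(1 - A) * (1 - A)^-r.+2 = (1 - A)^-r.+1]. *)
Lemma negbin_sumSS (K : fieldType) (A F : fps K) r N :
  negbin_sum A F r.+1 N.+1 = A * negbin_sum A F r.+1 N + negbin_sum A F r N.+1.
Proof.
rewrite /negbin_sum !big_nat_recl// !bin0 addrCA; congr (_ + _).
rewrite mulr_sumr -big_split; apply: eq_bigr => m _ /=.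
by rewrite addnS binS addSnnS addrC mulrnDr exprS mulrnAr !mulrA.
Qed.

(** Negative binomial theorem, as a coefficientwise limit. *)
Lemma cvg_negbin_sum (R : realType) (A F : fps R[i]) r :
  `|fps_coef A 0| < 1 -> forall n,
  (fun N => fps_coef (negbin_sum A F r N) n) @ \oo -->
    fps_coef ((1 - A) ^- r.+1 * F) n.
Proof.
move=> A1.
have uA : 1 - A \is a GRing.unit.
  rewrite fps_unitE -[fps_coef _ _]/(1 - fps_coef A 0) subr_eq0.
  by apply: contraTneq A1 => <-; rewrite normr1 ltxx.
elim: r => [|r IH] n.
  apply: (cvg_fps_affine_rec A1 (negbin_sum0S A F)) => k.
  by rewrite expr1 mulVKr//; exact: cvg_cst.
apply: (cvg_fps_affine_rec A1 (negbin_sumSS A F r)) => k.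
have -> : (1 - A) * ((1 - A) ^- r.+2 * F) = (1 - A) ^- r.+1 * F.
  by rewrite mulrA exprSr invrM ?unitrX// mulVKr.
move: (IH k).
by rewrite -(cvg_shiftS (fun N => fps_coef (negbin_sum A F r N) k)).
Qed.

(** The factor [t ^ r] of the generating function shifts the index by [r], and
    [(A - 1)^r] differs from [(1 - A)^r] by the sign [(-1)^r]. *)
Lemma apostol_mersenne_bernoulli_shift (K : numFieldType) r n (x lam : K) :
  (-1) ^+ r * ((mfact n)%:R / (mfact (n + r))%:R) *
    apostol_mersenne_bernoulli r (n + r) x lam =
  mcoef ((1 - lam *: mexp 1) ^- r * mexp x) n.
Proof.
rewrite /apostol_mersenne_bernoulli /mcoef.
have -> : (fps_t K / (lam *: mexp 1 - 1)) ^+ r * mexp x =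
    fps_t K ^+ r * ((-1) ^+ r *: ((1 - lam *: mexp 1) ^- r * mexp x)).
  rewrite -[lam *: _ - 1]opprB invrN mulrN.
  rewrite (exprNn (fps_t K / _)) exprMn exprVn -!mulrA.
  rewrite -scalerAr -[in LHS]signr_odd mulr_sign -[in RHS]signr_odd.
  by rewrite scaler_sign.
rewrite fps_coef_tXM fps_coefZ.
have mfact0 : (mfact (n + r))%:R != 0 :> K by rewrite pnatr_eq0 -lt0n mfact_gt0.
by rewrite mulrACA signrMK mulfVK.
Qed.

Unset Implicit Arguments.
Set Strict Implicit.

Theorem theorem5p3 (R : realType) (r n : nat) (x lam : R[i])
    (hr : (1 <= r)%N) (hlam : `|lam| < 1) :
  cvgn (series (mersenne_lerch_term r n x lam)) /\
  mersenne_lerch r n x lam =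
    (-1) ^+ r * ((mfact n)%:R / (mfact (n + r))%:R) *
      apostol_mersenne_bernoulli r (n + r) x lam.
Proof.
rewrite apostol_mersenne_bernoulli_shift//.
case: r hr => // r _.
pose A : fps R[i] := lam *: mexp 1.
have A1 : `|fps_coef A 0| < 1.
  by rewrite fps_coefZ /= /mfact big_geq// expr1n divr1 mulr1.
have cvgS : series (mersenne_lerch_term r.+1 n x lam) @ \oo -->
    mcoef ((1 - A) ^- r.+1 * mexp x) n.
  have -> : series (mersenne_lerch_term r.+1 n x lam) =
      (fun N => fps_coef (negbin_sum A (mexp x) r N) n * (mfact n)%:R).
    apply: funext => N; rewrite /series /= /negbin_sum fps_coef_sum mulr_suml.
    apply: eq_bigr => m _; rewrite /mersenne_lerch_term /mersenne_translation.
    rewrite /mcoef addnS subn1 fps_coefMn exprZn.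
    rewrite -(scalerAl _ (mexp 1 ^+ m)) fps_coefZ.
    by rewrite -!mulrA [mexp x * _]mulrC.
  by apply: cvgMr_tmp; exact: cvg_negbin_sum.
by split; [exact: cvgP cvgS | exact: cvg_lim cvgS].
Qed.
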